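(* Let $K$ be a field and let $A=K\langle X\rangle/(w_1,\dots,w_t)$ be a non-unital monomial associative algebra, where no $w_i$ is a subword of another $w_j$ and no $w_i$ is an element of $X$. Let $w=x_1\cdots x_n$ be a word in the letters of $X$, and let $(B_w,D)$ be the subcomplex of the bar complex of $A$ associated with $w$. Then the total homology of $B_w$ is at most one-dimensional: $$\dim_K H_\bullet(B_w)=\dim_K\big(\ker D/\operatorname{im} D\big)\in\{0,1\}.$$
   Context: $K\langle X\rangle$ is the free associative algebra without unit on the set $X$ (with basis the nonempty words in $X$), and $A$ is its quotient by the two-sided ideal generated by the words (monomials) $w_1,\dots,w_t$. A basis of $A$ is given by the nonempty words containing no $w_i$ as a subword (contiguous factor); all other words are zero in $A$. For a word $w=x_1\cdots x_n$, the complex $B_w$ is $$0\to B_n\xrightarrow{D}B_{n-1}\xrightarrow{D}\cdots\xrightarrow{D}B_1\to 0,$$ where $B_k\subset A^{\otimes k}$ is the $K$-span of the tensors $u_1\otimes\cdots\otimes u_k$ such that $u_1,\dots,u_k$ are nonempty words whose concatenation $u_1u_2\cdots u_k$ is the word $w$ and each $u_j$ is nonzero in $A$. The differential is $$D(u_1\otimes\cdots\otimes u_k)=\sum_{i=1}^{k-1}(-1)^{i-1}u_1\otimes\cdots\otimes u_iu_{i+1}\otimes\cdots\otimes u_k,$$ where the product $u_iu_{i+1}$ is taken in $A$ (so a term is $0$ when $u_iu_{i+1}=0$ in $A$). Put $B=\bigoplus_k B_k$ and regard $D$ as a linear map $B\to B$ with $D^2=0$. *)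

(* Defs.v *)
From HB Require Import structures.
From mathcomp Require Import all_boot all_order all_algebra.
From mathcomp Require Import boolp monalg.

Set Implicit Arguments.
Unset Strict Implicit.
Unset Printing Implicit Defensive.

Import GRing.Theory.
Local Open Scope ring_scope.

Section FreeAlgebra.
Variables (K : fieldType) (X : choiceType).

(* The monoid algebra of the free monoid is the unital free algebra; the
   non-unital one, K<X>, is the subspace spanned by the nonempty words. *)
Notation unital_free := {malg K[{fmonom X}]}.

Definition in_free (a : unital_free) : Prop := a@_(mone : {fmonom X}) = 0.

Definition mono (u : seq X) : unital_free := << FMonom u >>.

Variables (t : nat) (ws : 'I_t -> seq X).

(* The two-sided ideal of the K-algebra K<X> generated by the words ws i.
   Since K<X> has no unit, closure under scalars is a separate clause. *)
Inductive in_ideal : unital_free -> Prop :=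
| ideal_gen i : in_ideal (mono (ws i))
| ideal_0 : in_ideal 0
| ideal_add a b : in_ideal a -> in_ideal b -> in_ideal (a + b)
| ideal_scale (c : K) a : in_ideal a -> in_ideal (c *: a)
| ideal_mull a b : in_free a -> in_ideal b -> in_ideal (a * b)
| ideal_mulr a b : in_ideal a -> in_free b -> in_ideal (a * b).

Definition nonzero_in_A (u : seq X) : bool := ~~ `[< in_ideal (mono u) >].

Lemma monoM u v : mono (u ++ v) = mono u * mono v.
Proof.
rewrite /mono malgM_def fgmulUU mulr1.
by congr (<< _ *g _ >>); rewrite /mmul /= fmmulE.
Qed.

Lemma in_free_mono u : u != [::] -> in_free (mono u).
Proof.
move=> un0; rewrite /in_free /mono mcoeffU1.
have -> : (FMonom u == mone) = false; last by [].
by apply: contraNF un0 => /eqP; rewrite /mone /= fmoneE => -[->].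
Qed.

Lemma in_ideal_infix a : in_ideal a ->
  forall m : {fmonom X}, a@_m != 0 -> exists i, infix (ws i) m.
Proof.
elim=> {a}.
- move=> i m; rewrite /mono mcoeffU1.
  have [<- _|_] := eqVneq (FMonom (ws i)) m; last by rewrite eqxx.
  by exists i => /=; exact: infix_refl.
- by move=> m; rewrite mcoeff0 eqxx.
- move=> a b _ IHa _ IHb m; rewrite mcoeffD.
  have [->|/IHa] := eqVneq a@_m 0; last by [].
  by rewrite add0r => /IHb.
- move=> c a _ IHa m; rewrite mcoeffZ mulf_eq0 negb_or => /andP[_]; exact: IHa.
- move=> a b _ _ IHb m; rewrite mcoeff_neq0 => /msuppM_le.
  case=> p [q [_ qb ->]]; have [|i] := IHb q; first by rewrite mcoeff_neq0.
  by move=> wq; exists i; rewrite /mmul /= fmmulE /=; exact: infix_catl.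
- move=> a b _ IHa _ m; rewrite mcoeff_neq0 => /msuppM_le.
  case=> p [q [pa _ ->]]; have [|i] := IHa p; first by rewrite mcoeff_neq0.
  by move=> wq; exists i; rewrite /mmul /= fmmulE /=; exact: infix_catr.
Qed.

Lemma nonzero_in_AE u : nonzero_in_A u = [forall i, ~~ infix (ws i) u].
Proof.
rewrite /nonzero_in_A -negb_exists; congr (~~ _).
apply/asboolP/existsP => [/in_ideal_infix/(_ (FMonom u))|[i]].
  by apply; rewrite /mono mcoeffUU oner_neq0.
case/infixP=> p [q ->]; rewrite !monoM.
have Hr : in_ideal (mono (ws i) * mono q).
  have [->|q0] := eqVneq q [::]; first by rewrite -monoM cats0; exact: ideal_gen.
  by apply: ideal_mulr; [exact: ideal_gen|exact: in_free_mono].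
have [->|p0] := eqVneq p [::]; first by rewrite -!monoM in Hr *.
by apply: ideal_mull => //; exact: in_free_mono.
Qed.

Lemma nonzero_in_A_cat u v :
  nonzero_in_A (u ++ v) -> nonzero_in_A u && nonzero_in_A v.
Proof.
rewrite !nonzero_in_AE => /forallP H; apply/andP; split; apply/forallP => i;
  apply: contra (H i) => Hi; [exact: infix_catr|exact: infix_catl].
Qed.

End FreeAlgebra.

Fixpoint factorizations (X : Type) (w : seq X) : seq (seq (seq X)) :=
  if w is x :: w' then
    flatten [seq ([:: x] :: us) ::
                 (if us is u :: us' then [:: (x :: u) :: us'] else [::])
            | us <- factorizations w']
  else [:: [::]].

Lemma mem_factorizations (X : eqType) (us : seq (seq X)) :
  [::] \notin us -> us \in factorizations (flatten us).
Proof.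
move: {2}(flatten us) (erefl (flatten us)) => w.
elim: w us => [|x w IHw] [|[|y u] us] //=.
case=> -> Ew; rewrite inE => /= Hus; rewrite Ew.
case: u Ew => [|z u] Ew.
- apply/flatten_mapP; exists us; first by rewrite -Ew; apply: IHw.
  by rewrite inE eqxx.
- apply/flatten_mapP; exists ((z :: u) :: us).
    by rewrite -Ew; apply: IHw => //; rewrite inE.
  by rewrite !inE eqxx orbT.
Qed.

Section Merge.
Variable X : eqType.
Implicit Types us : seq (seq X).

Definition merge_at (i : nat) (us : seq (seq X)) : seq (seq X) :=
  take i us ++ (nth [::] us i ++ nth [::] us i.+1) :: drop i.+2 us.

Lemma merge_at0 u v us : merge_at 0 [:: u, v & us] = (u ++ v) :: us.
Proof. by rewrite /merge_at /= drop0. Qed.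

Lemma merge_atS i u us : merge_at i.+1 (u :: us) = u :: merge_at i us.
Proof. by []. Qed.

Lemma size_merge_at i us :
  (i.+1 < size us)%N -> size (merge_at i us) = (size us).-1.
Proof.
elim: i us => [|i IHi] [|u [|v us]] // lt_i; first by rewrite merge_at0.
by rewrite merge_atS [LHS]/= IHi.
Qed.

Lemma flatten_merge_at i us :
  (i.+1 < size us)%N -> flatten (merge_at i us) = flatten us.
Proof.
elim: i us => [|i IHi] [|u [|v us]] // lt_i; first by rewrite merge_at0 /= catA.
by rewrite merge_atS [LHS]/= IHi.
Qed.

Lemma nil_merge_at i us : (i.+1 < size us)%N ->
  [::] \notin us -> [::] \notin merge_at i us.
Proof.
elim: i us => [|i IHi] [|u [|v us]] // lt_i.
  rewrite merge_at0 !inE; case: u lt_i => [|x u] //= _.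
  by rewrite negb_or => /andP[].
have Hc (r : seq (seq X)) :
    ([::] \notin u :: r) = ([::] != u) && ([::] \notin r).
  by rewrite in_cons negb_or.
by rewrite merge_atS !Hc => /andP[-> Hv]; rewrite IHi.
Qed.

Lemma all_merge_at (P : pred (seq X)) i us :
  (forall u v, P (u ++ v) -> P u && P v) ->
  (i.+1 < size us)%N -> all P (merge_at i us) -> all P us.
Proof.
move=> HP; elim: i us => [|i IHi] [|u [|v us]] // lt_i.
  by rewrite merge_at0 /= => /andP[/HP/andP[-> ->] ->].
by rewrite merge_atS [all P (u :: _)]/= => /andP[Hu /IHi] /= -> //; rewrite Hu.
Qed.

Lemma merge_at_merge_at i j us : (i <= j)%N -> (j.+2 < size us)%N ->
  merge_at j (merge_at i us) = merge_at i (merge_at j.+1 us).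
Proof.
elim: us i j => [|u us IHus] [|i] [|j] // le_ij lt_j.
- by case: us lt_j {IHus} => [|v [|x us]] // _; rewrite !(merge_at0, merge_atS) catA.
- by case: us lt_j {IHus} => [|v us] // _; rewrite !(merge_at0, merge_atS).
- by rewrite !merge_atS IHus.
Qed.

End Merge.

Section BarComplex.
Variables (K : fieldType) (X : choiceType).
Variables (t : nat) (ws : 'I_t -> seq X) (w : seq X).

(* [:: u_1; ...; u_k] stands for u_1 (x) ... (x) u_k; the classes of the words
   nonzero in A are a basis of A (see nonzero_in_AE), so these tensors form a
   basis of B_w, the sum of the B_k over all k >= 1. *)
Definition is_bar_tensor (us : seq (seq X)) : bool :=
  [&& us != [::], [::] \notin us, flatten us == w
    & all (nonzero_in_A K ws) us].

Record bar_tensor : predArgType :=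
  BarTensor { tensor_val : seq (seq X); _ : is_bar_tensor tensor_val }.

HB.instance Definition _ := [isSub for tensor_val].
HB.instance Definition _ := [Choice of bar_tensor by <:].

Lemma bar_tensor_factorization (b : bar_tensor) :
  val b \in factorizations w.
Proof.
by case: b => us /= /and4P[_ us0 /eqP <- _]; exact: mem_factorizations.
Qed.

Definition bar_code (b : bar_tensor) : seq_sub (factorizations w) :=
  SeqSub (bar_tensor_factorization b).

Lemma bar_codeK : pcancel bar_code (fun s => insub (val s)).
Proof. exact: valK. Qed.

HB.instance Definition _ : isCountable bar_tensor := PCanIsCountable bar_codeK.
HB.instance Definition _ : isFinite bar_tensor := PCanIsFinite bar_codeK.

Definition bar : vectType K := {ffun bar_tensor -> K^o}.

(* This is 0 when us is not a basis tensor; for us a factorization of w into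
   nonempty words, that is when some factor is zero in A. *)
Definition tensor (us : seq (seq X)) : bar := [ffun b => (val b == us)%:R].

(* The indices start at 0, hence the sign (-1) ^+ i. *)
Definition d_tensor (us : seq (seq X)) : bar :=
  \sum_(i < (size us).-1) (-1) ^+ i *: tensor (merge_at i us).

Definition bar_d_fun (f : bar) : bar :=
  \sum_(b : bar_tensor) f b *: d_tensor (val b).

Lemma bar_d_fun_linear : linear bar_d_fun.
Proof.
move=> c f g; rewrite /bar_d_fun scaler_sumr -big_split /=.
by apply: eq_bigr => b _; rewrite !ffunE scalerDl scalerA.
Qed.

HB.instance Definition _ :=
  GRing.isLinear.Build K bar bar *:%R bar_d_fun bar_d_fun_linear.

Definition bar_d : 'End(bar) := linfun bar_d_fun.

Let is_fact (us : seq (seq X)) :=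
  [&& us != [::], [::] \notin us & flatten us == w].

Let is_fact_merge i us :
  (i.+1 < size us)%N -> is_fact us -> is_fact (merge_at i us).
Proof.
move=> lt_i /and3P[_ us0 /eqP Ew]; apply/and3P; split.
- by rewrite -size_eq0 size_merge_at //; case: us lt_i {us0 Ew} => [|? []].
- exact: nil_merge_at.
- by rewrite flatten_merge_at // Ew.
Qed.

Let tensor_eq0 us : ~~ is_bar_tensor us -> tensor us = 0.
Proof.
move=> Nus; apply/ffunP => b; rewrite !ffunE.
by case: eqP Nus => // <-; rewrite (valP b).
Qed.

Let bar_d_fun_tensor us : is_fact us -> bar_d_fun (tensor us) = d_tensor us.
Proof.
move=> us_fact; have [Hus|Nus] := boolP (is_bar_tensor us).
  rewrite /bar_d_fun (bigD1 (BarTensor Hus)) //= ffunE eqxx scale1r.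
  rewrite big1 ?addr0 // => b; rewrite ffunE -val_eqE /= => /negPf ->.
  by rewrite scale0r.
rewrite tensor_eq0 // linear0 /d_tensor big1 // => i _.
have lt_i : (i.+1 < size us)%N by case: (size us) i => [|[|n]] [].
rewrite tensor_eq0 ?scaler0 //; apply: contra Nus => /and4P[_ _ _ Hall].
case/and3P: us_fact => u0 un0 Ew; apply/and4P; split=> //.
by apply: all_merge_at Hall => //; exact: nonzero_in_A_cat.
Qed.

Let bar_d_fun_d_tensor us : is_fact us -> bar_d_fun (d_tensor us) = 0.
Proof.
move=> us_fact; rewrite /d_tensor linear_sum /=.
case Em: (size us).-1 => [|m]; first by rewrite big_ord0.
have sz : size us = m.+2 by case: (size us) Em => // ? /= ->.
pose T i j := (-1) ^+ (i + j) *: tensor (merge_at j (merge_at i us)).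
transitivity (\sum_(i < m.+1) \sum_(j < m) T i j).
  apply: eq_bigr => i _.
  have lt_i : (i.+1 < size us)%N by rewrite sz ltnS ltn_ord.
  rewrite linearZ /= bar_d_fun_tensor ?is_fact_merge // /d_tensor.
  rewrite size_merge_at // sz /= scaler_sumr.
  by apply: eq_bigr => j _; rewrite scalerA -exprD.
under eq_bigr => i _ do
  rewrite (bigID (fun j : 'I_m => (i <= j)%N)) /=.
rewrite big_split /= big_ord_recr /= [X in _ + X + _]big1 ?addr0; last first.
  by move=> j; rewrite leqNgt ltn_ord.
rewrite [X in _ + X]big_ord_recl /= [X in _ + (X + _)]big1 ?add0r; last by [].
under [X in _ + X]eq_bigr => i _ do rewrite big_mkcond.
rewrite [X in _ + X]exchange_big /= -big_split big1 //= => a _.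
rewrite [X in X + _]big_mkcond -big_split big1 //= => b _.
rewrite /bump /= add1n -leqNgt; have [le_ab|lt_ba] := leqP a b.
  rewrite /T merge_at_merge_at // ?sz ?ltnS // addSn exprS mulN1r scaleNr.
  by rewrite addnC subrr.
by rewrite addr0.
Qed.

Lemma bar_dd0 f : bar_d (bar_d f) = 0.
Proof.
rewrite !lfunE /= {2}/bar_d_fun linear_sum big1 // => b _.
rewrite linearZ /= bar_d_fun_d_tensor ?scaler0 //.
by apply/and3P; case/and4P: (valP b).
Qed.

Lemma limg_bar_d : (limg bar_d <= lker bar_d)%VS.
Proof.
by apply/subvP => _ /memv_imgP[f _ ->]; rewrite memv_ker bar_dd0.
Qed.

(* A complement of im D in ker D, that is, a copy of ker D / im D (im D is
   contained in ker D by limg_bar_d). *)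
Definition bar_homology : {vspace bar} := (lker bar_d :\: limg bar_d)%VS.

End BarComplex.

(* Main.v *)
(* Suppose all tensors in play begin with a factor having p as a prefix. Those
   of the form p (x) u (x) ... with pu nonzero in A cancel against pu (x) ...,
   so up to boundaries a cycle is supported on the p (x) u (x) ... with pu zero
   in A, that is, with u beginning with the shortest q such that pq is zero in
   A. Iterating from the first letter of w builds a chain p (x) q (x) ... in at
   most one way, and only such a chain, if it exhausts w, can carry homology. *)
Require Import Defs.
From HB Require Import structures.
From mathcomp Require Import all_boot all_order all_algebra.

Set Implicit Arguments.
Unset Strict Implicit.
Unset Printing Implicit Defensive.

Section Homology.
Import GRing.Theory.
Local Open Scope ring_scope.
Variables (K : fieldType) (X : choiceType) (t : nat) (ws : 'I_t -> seq X).
Variable w : seq X.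

Local Notation nz := (nonzero_in_A K ws).
Local Notation bar := (bar K ws w).
Local Notation tensor := (tensor K ws w).
Local Notation d_tensor := (d_tensor K ws w).
Local Notation bar_d := (bar_d K ws w).
Implicit Types (h us : seq (seq X)) (p q r u v : seq X).
Implicit Types (b : bar_tensor K ws w) (y z : bar).

(** * Coordinates of the differential *)

Definition supported (P : pred (seq (seq X))) z :=
  forall b, ~~ P (val b) -> z b = 0.

Lemma nz_catl u v : nz (u ++ v) -> nz u.
Proof. by case/nonzero_in_A_cat/andP. Qed.

Lemma bar_tensor_sum z : z = \sum_b z b *: tensor (val b).
Proof.
apply/ffunP => b; rewrite sum_ffunE (bigD1 b) //= big1 => [|b' neq].
  by rewrite addr0 !ffunE eqxx /GRing.scale /= mulr1.
by rewrite !ffunE (inj_eq val_inj) eq_sym (negPf neq) scaler0.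
Qed.

Lemma bar_d_app z b : bar_d z b = \sum_b' z b' * d_tensor (val b') b.
Proof.
rewrite lfunE /= /bar_d_fun sum_ffunE; apply: eq_bigr => b' _.
by rewrite ffunE.
Qed.

Lemma bar_d_tensor b : bar_d (tensor (val b)) = d_tensor (val b).
Proof.
apply/ffunP => b1; rewrite bar_d_app (bigD1 b) //= big1 => [|b' neq].
  by rewrite addr0 !ffunE eqxx mul1r.
by rewrite ffunE (inj_eq val_inj) (negPf neq) mul0r.
Qed.

(** If [h] is sorted for this relation, the merges inside [h] all vanish in A and contribute nothing
    to the differential. *)
Definition zero_pair u v := ~~ nz (u ++ v).

Lemma merge_at_cat h us i :
  merge_at (size h + i) (h ++ us) = h ++ merge_at i us.
Proof. by elim: h => //= u h IHh; rewrite addSn merge_atS IHh. Qed.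

Lemma not_all_nz_merge_at h p us i : sorted zero_pair (rcons h p) ->
  (i < size h)%N -> ~~ all nz (merge_at i (h ++ p :: us)).
Proof.
move=> /(sortedP [::]) Hs lt_i; rewrite /merge_at all_cat /= !negb_and.
have := Hs i; rewrite size_rcons ltnS => /(_ lt_i).
rewrite /zero_pair -cat_rcons nth_cat size_rcons (ltn_trans lt_i) //.
by rewrite nth_cat size_rcons ltnS lt_i => ->; rewrite orbT.
Qed.

(* Outside the tensors beginning with h, p, only the merge of p and v remains. *)
Lemma d_tensor_off_prefix h p v us b :
  sorted zero_pair (rcons h p) -> ~~ prefix (rcons h p) (val b) ->
  d_tensor (h ++ [:: p, v & us]) b =
    (-1) ^+ size h * (val b == h ++ (p ++ v) :: us)%:R.
Proof.
move=> Hs Nb; rewrite /Defs.d_tensor sum_ffunE.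
have lt_h : (size h < (size (h ++ [:: p, v & us])).-1)%N.
  by rewrite size_cat /= !addnS ltnS leq_addr.
rewrite (bigD1 (Ordinal lt_h)) //= big1 ?addr0 => [|i neq_i].
  by rewrite !ffunE -{1}[size h]addn0 addn0 -{2}[size h]addn0 merge_at_cat merge_at0.
rewrite !ffunE; case: eqP => [Eb|_]; last by rewrite scaler0.
(* A merge inside [h], [p] creates a factor zero in A, so it cannot be [b]. A merge further right
   keeps [h], [p] as first factors, which [b] does not have. *)
case: (ltngtP i (size h)) => [lt_i|gt_i|eq_i].
- have := not_all_nz_merge_at (v :: us) Hs lt_i; rewrite -Eb.
  by case/and4P: (valP b) => _ _ _ ->.
- case/negP: Nb; rewrite Eb -(subnKC gt_i) addSnnS merge_at_cat merge_atS.
  by apply/prefixP; eexists; rewrite cat_rcons.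
- by case/eqP: neq_i; apply: val_inj.
Qed.

(** * Reduction of cycles along a chain *)

Definition starts h p us := prefix h us && prefix p (nth [::] us (size h)).

(** A nonempty [p] is not a prefix of the default [[::]] of [nth], so a factor after [h] must
    exist. *)
Lemma startsP h p us : p != [::] ->
  reflect (exists v us', us = h ++ (p ++ v) :: us') (starts h p us).
Proof.
move=> p0; apply: (iffP andP) => [[/prefixP[us1 ->]]|[v [us' ->]]].
  rewrite nth_cat ltnn subnn; case: us1 => [|u us1].
    by rewrite prefixs0 (negPf p0).
  by rewrite [nth _ _ _]/= => /prefixP[v ->]; exists v, us1.
by rewrite prefix_prefix nth_cat ltnn subnn /= prefix_prefix.
Qed.

(* Splitting p off the factor p ++ v is a contracting homotopy modulo the
   tensors beginning with h, p. *)
Lemma split_prefix h p z : p != [::] -> sorted zero_pair (rcons h p) ->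
  supported (starts h p) z ->
  exists y, supported (prefix (rcons h p)) (z - bar_d y).
Proof.
move=> p0 Hs Hz; rewrite [z]bar_tensor_sum.
(* The property is stable under sums, so one basis tensor is treated at a time. *)
apply: (big_ind (fun z => exists y, supported (prefix (rcons h p)) (z - bar_d y))).
- by exists 0 => b _; rewrite linear0 subr0 ffunE.
- move=> z1 z2 [y1 H1] [y2 H2]; exists (y1 + y2) => b Nb.
  by rewrite linearD opprD addrACA ffunE H1 // H2 // addr0.
move=> b _; have [Sb|/Hz ->] := boolP (starts h p (val b)); last first.
  by exists 0 => b' _; rewrite scale0r linear0 subr0 ffunE.
have /(startsP _ _ p0)[v [us Eb]] := Sb.
have [v0|v0] := eqVneq v [::].
  exists 0 => b' Nb'; rewrite linear0 subr0 !ffunE.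
  case: eqP => [E|_]; last by rewrite scaler0.
  by case/negP: Nb'; rewrite E Eb v0 cats0 -cat_rcons prefix_prefix.
have Hb2 : is_bar_tensor K ws w (h ++ [:: p, v & us]).
  case/and4P: (valP b); rewrite Eb => _ b0 Ew nzb; apply/and4P; split.
  - by case: (h).
  - move: b0; rewrite !mem_cat !inE !negb_or => /and3P[-> _ ->].
    by rewrite ![[::] == _]eq_sym p0 v0.
  - by rewrite -(eqP Ew) !flatten_cat /= !catA.
  - move: nzb; rewrite !all_cat /= => /and3P[-> /nonzero_in_A_cat/andP[-> ->] ->].
    by [].
(* The factor [(-1) ^+ size h] undoes the sign with which merging [p] and [v] enters the
   differential. *)
exists ((z b * (-1) ^+ size h) *: tensor (val (BarTensor Hb2))) => b' Nb'.
rewrite linearZ /= (bar_d_tensor (BarTensor Hb2)) /= !(ffunE, d_tensor_off_prefix) //.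
rewrite -Eb.
rewrite /GRing.scale /= -mulrA [(-1) ^+ _ * (_ * _)]mulrA -exprMn mulrNN mulr1.
by rewrite expr1n mul1r eq_sym subrr.
Qed.

(** Among the tensors beginning with [h], [p], only [b] has the tensor [h ++ (p ++ u) :: us] in its
    differential. The coefficient of [bar_d z] there is thus [z b] up to sign. *)
Lemma cycle_zero_pair h p z b u us : sorted zero_pair (rcons h p) ->
  supported (prefix (rcons h p)) z -> bar_d z = 0 ->
  val b = h ++ [:: p, u & us] -> nz (p ++ u) -> z b = 0.
Proof.
move=> Hs Hz dz0 Eb nzpu.
have /and4P[_ b0 Ew nzb] := valP b.
have u0 : u != [::].
  by apply: contraNneq b0 => u0; rewrite Eb u0 mem_cat !inE eqxx !orbT.
have p0 : p != [::].
  by apply: contraNneq b0 => p0; rewrite Eb p0 mem_cat !inE eqxx !orbT.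
have Hb1 : is_bar_tensor K ws w (h ++ (p ++ u) :: us).
  rewrite Eb in b0 Ew nzb; apply/and4P; split.
  - by case: (h).
  - move: b0; rewrite !mem_cat !inE !negb_or => /and4P[-> _ _ ->].
    by case: (p) p0.
  - by rewrite -(eqP Ew) !flatten_cat /= !catA.
  - by move: nzb; rewrite !all_cat /= nzpu => /and4P[-> _ _ ->].
have Nb1 : ~~ prefix (rcons h p) (h ++ (p ++ u) :: us).
  apply/prefixP => -[s /eqP]; rewrite cat_rcons eqseq_cat // eqxx /= eqseq_cons.
  case/andP=> /eqP/(congr1 size)/eqP; rewrite size_cat -{2}[size p]addn0.
  by rewrite eqn_add2l size_eq0 (negPf u0).
have := congr1 (fun f : bar => f (BarTensor Hb1)) dz0.
rewrite bar_d_app ffunE (bigD1 b) //= big1 ?addr0 => [|b' neq].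
  rewrite Eb d_tensor_off_prefix //= eqxx mulr1 => /eqP.
  by rewrite mulf_eq0 signr_eq0 orbF => /eqP.
have [Qb'|/Hz ->] := boolP (prefix (rcons h p) (val b')); last by rewrite mul0r.
have /prefixP[us' E'] := Qb'.
(* [b'] cannot end at [p]: as [u] is nonempty, its concatenation would be shorter than [w]. *)
rewrite E' cat_rcons; case: us' E' => [|v us'] E'.
  have /and4P[_ _ Ew' _] := valP b'; have /and4P[_ _ Ew1 _] := Hb1.
  exfalso; move: Ew'; rewrite E' cats0 -(eqP Ew1) -cats1 !flatten_cat /= cats0.
  rewrite eqseq_cat // eqxx /= -catA -{1}[p]cats0 eqseq_cat // eqxx /=.
  by case: (u) u0.
rewrite d_tensor_off_prefix //=; case: eqP => [/eqP|_]; last first.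
  by rewrite !mulr0.
rewrite eqseq_cat // eqxx /= eqseq_cons eqseq_cat // eqxx /= => /andP[/eqP Eu /eqP Eus].
by case/eqP: neq; apply: val_inj; rewrite Eb E' cat_rcons Eu Eus.
Qed.

(* The chains p_1, p_2, ... built here are those of Anick's resolution. *)
Lemma cycles_starting h p r :
  p != [::] -> flatten h ++ p ++ r = w -> sorted zero_pair (rcons h p) ->
  exists c : bar, forall z, supported (starts h p) z -> bar_d z = 0 ->
    exists (a : K) y, z = a *: c + bar_d y.
Proof.
(* Induction on the length of [r], the part of [w] not yet covered by the chain. *)
have [m] := ubnP (size r); elim: m => // m IHm in h p r *.
rewrite ltnS => le_rm p0 Ew Hs.
have supp0 P z : supported P z -> (forall b, ~~ P (val b)) -> z = 0.
  by move=> Hz NP; apply/ffunP => b; rewrite Hz ?ffunE.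
have [nzp|Np] := boolP (nz p); last first.
  exists 0 => z Hz _; exists 0, 0; rewrite scaler0 linear0 addr0.
  apply: (supp0 _ _ Hz) => b; apply/negP => /(startsP _ _ p0)[v [us Eb]].
  case/and4P: (valP b) => _ _ _; rewrite Eb all_cat /= => /and3P[_ /nz_catl].
  by rewrite (negPf Np).
(* Up to a boundary, [split_prefix] and [cycle_zero_pair] leave only tensors in which [p] is a
   factor whose product with the next one is zero in A. *)
have step c : (forall z, supported (fun us => prefix (rcons h p) us &&
      ~~ nz (p ++ nth [::] us (size h).+1)) z -> bar_d z = 0 ->
      exists (a : K) y, z = a *: c + bar_d y) ->
   r != [::] ->
   forall z, supported (starts h p) z -> bar_d z = 0 ->
    exists (a : K) y, z = a *: c + bar_d y.
  move=> Hc r0 z Hz dz; have [y0 Hy0] := split_prefix p0 Hs Hz.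
  have dzy : bar_d (z - bar_d y0) = 0 by rewrite linearB /= dz bar_dd0 subr0.
  have [||a [y Ey]] := Hc (z - bar_d y0) => //.
    move=> b; have [Qb|Nb _] := boolP (prefix _ _); last exact: Hy0.
    rewrite negbK; have /prefixP[us Eb] := Qb.
    rewrite Eb nth_cat size_rcons ltnn subnn.
    case: us Eb => [|u us] Eb.
      (* Since [r] is nonempty, no tensor ends at [p], and the default of [nth] is never reached. *)
      exfalso; have /and4P[_ _ + _] := valP b.
      rewrite Eb cats0 -cats1 flatten_cat /= -Ew eqseq_cat // eqxx eqseq_cat //.
      by rewrite eqxx eq_sym (negPf r0).
    by move=> /= nzpu; apply: (cycle_zero_pair Hs Hy0 dzy _ nzpu); rewrite Eb cat_rcons.
  by exists a, (y + y0); rewrite linearD addrA -Ey subrK.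
have flat b u us : val b = rcons h p ++ u :: us -> exists s, r = u ++ s.
  move=> Eb; case/and4P: (valP b) => _ _ /eqP.
  rewrite Eb -cats1 -catA flatten_cat /= -Ew => /eqP.
  by rewrite !eqseq_cat // !eqxx /= => /eqP <-; exists (flatten us).
have [r0|r0] := eqVneq r [::].
  (* The chain exhausts [w], and every basis tensor allowed in the support is the chain itself. *)
  exists (tensor (rcons h p)) => z Hz _.
  have E b : starts h p (val b) -> val b = rcons h p.
    move/(startsP _ _ p0) => [v [us Eb]]; rewrite Eb.
    have /and4P[_ b0 /eqP] := valP b; rewrite Eb flatten_cat /= -Ew r0 => Er.
    move: b0; rewrite Eb mem_cat inE !negb_or => /and3P[_ _ us0].
    move/eqP: Er; rewrite eqseq_cat // eqxx -catA eqseq_cat // eqxx /=.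
    rewrite -size_eq0 size_cat addn_eq0 !size_eq0 => /andP[/eqP -> /eqP].
    by case: (us) us0 => [|[|x u] us'] //; rewrite cats0 -cats1.
  have [b /E Eb|N] := pickP (fun b => starts h p (val b)).
    exists (z b), 0; rewrite linear0 addr0; apply/ffunP => b'; rewrite !ffunE.
    have [E'|N'] := eqVneq (val b') (rcons h p).
      by rewrite /GRing.scale /= mulr1; congr (z _); apply: val_inj; rewrite E' Eb.
    by rewrite Hz ?scaler0 //; apply: contraNN N' => /E ->.
  exists 0, 0; rewrite linear0 scale0r addr0.
  by apply: (supp0 _ _ Hz) => b; rewrite N.
have [nzpr|Npr] := boolP (nz (p ++ r)).
  (* A factor following [p] is a prefix of [r], so its product with [p] is nonzero in A: no tensor
     survives the reduction. *)
  exists 0; apply: step => // z Hz _; exists 0, 0.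
  rewrite scaler0 linear0 addr0; apply: (supp0 _ _ Hz) => b.
  apply/negP => /andP[/prefixP[us Eb]]; rewrite Eb nth_cat size_rcons ltnn subnn.
  case: us Eb => [|u us] Eb /=; first by rewrite cats0 nzp.
  by have [s Er] := flat _ _ _ Eb; move: nzpr; rewrite Er catA => /nz_catl ->.
(* For the least such [k], [take k r] is the next link of the chain. *)
have exk : exists k, ~~ nz (p ++ take k r) by exists (size r); rewrite take_size.
case: (ex_minnP exk) => k Nk mink.
have k0 : (0 < k)%N by case: k Nk {mink} => //; rewrite take0 cats0 nzp.
have q0 : take k r != [::] by case: (k) k0 (r) r0 => // ? _ [].
have [||||c Hc] := IHm (rcons h p) (take k r) (drop k r).
- rewrite size_drop; apply: leq_trans le_rm.
  by rewrite ltn_subrL k0 lt0n size_eq0.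
- by [].
- by rewrite cat_take_drop -cats1 flatten_cat /= cats0 -catA.
- move: Hs; case: (h) => [|u h'] /=; first by rewrite andbT.
  by rewrite !rcons_path last_rcons => ->.
exists c; apply: step => // z Hz dz; apply: Hc => // b Nb; apply: Hz.
apply: contraNN Nb => /andP[Qb Nu]; rewrite /starts Qb size_rcons.
have /prefixP[us Eb] := Qb; move: Nu; rewrite Eb nth_cat size_rcons ltnn subnn.
case: us Eb => [|u us] Eb /=; first by rewrite cats0 nzp.
(* [u] is a prefix of [r] with [p ++ u] zero in A, so by minimality of [k] it begins with
   [take k r]. *)
have [s Er] := flat _ _ _ Eb => Nu; have le_ku : (k <= size u)%N.
  by apply: mink; rewrite Er take_size_cat.
by rewrite Er takel_cat // prefix_take.
Qed.

(** * From chains to the dimension bound *)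

Lemma cycles_mod_boundaries : exists c : bar, forall z, bar_d z = 0 ->
  exists (a : K) y, z = a *: c + bar_d y.
Proof.
have [w' Ew] : exists w', w' = w by exists w.
case: w' Ew => [|x r] Ew.
  (* The empty word has no factorization into at least one nonempty word, so the complex is zero. *)
  exists 0 => z _; exists 0, 0; rewrite scaler0 linear0 addr0.
  apply/ffunP => b; have /and4P[+ + /eqP Eb _] := valP b.
  by move: (etrans Eb (esym Ew)); case: (val b) => [|[|x u] us].
(* The first factor of every tensor begins with the first letter [x] of [w]. *)
have [|||c Hc] := @cycles_starting [::] [:: x] r; rewrite ?Ew //.
exists c => z dz; apply: Hc => // b /negP[]; rewrite /starts.
have /and4P[+ + /eqP Eb _] := valP b.
move: (etrans Eb (esym Ew)); case: (val b) => [|[|x' u] us] //= [-> _] _ _.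
by rewrite eqxx prefix0s.
Qed.

Lemma dim_bar_homology_le1 : (\dim (bar_homology K ws w) <= 1)%N.
Proof.
have [c Hc] := cycles_mod_boundaries.
have le_ker : (lker bar_d <= <[c]> + limg bar_d)%VS.
  apply/subvP => z; rewrite memv_ker => /eqP/Hc[a [y ->]].
  by rewrite memv_add ?memvZ ?memv_line // memv_img ?memvf.
have := dimv_cap_compl (lker bar_d) (limg bar_d).
(* As im D lies in ker D, the dimensions of im D and of the homology add up to that of ker D. *)
rewrite (capv_idPr (limg_bar_d K ws w)) -/(bar_homology K ws w) => Edim.
rewrite -(leq_add2l (\dim (limg bar_d))) Edim addnC.
apply: leq_trans (dimvS le_ker) _; apply: leq_trans (dimv_add_leqif _ _).1 _.
by rewrite leq_add2r dim_vline leq_b1.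
Qed.

End Homology.

Theorem theorem2p1 (K : fieldType) (X : choiceType)
    (t : nat) (ws : 'I_t -> seq X)
    (ws_nonempty : forall i : 'I_t, ws i != [::])
    (ws_not_letter : forall (i : 'I_t) (x : X), ws i != [:: x])
    (ws_not_subword : forall i j : 'I_t, i != j -> ~~ infix (ws i) (ws j))
    (w : seq X) :
  \dim (bar_homology K ws w) \in [:: 0; 1].
Proof.
by have := dim_bar_homology_le1 K ws w; case: (\dim _) => [|[]].
Qed.
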